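(* Let $\langle A,\preceq_A\rangle$, $\langle B,\preceq_B\rangle$, $\langle C,\preceq_C\rangle$ be preordered sets and let $f:C\to A$ and $g:C\to B$ be monotonic functions. Let $\langle A+B,\preceq_{A+B}\rangle$ be the coproduct preorder, with inclusions $i_A:A\to A+B$ and $i_B:B\to A+B$. Let $R^e$ be the least equivalence relation on $A+B$ containing $\{\langle i_A(f(c)),i_B(g(c))\rangle : c\in C\}$, and let $[\cdot]:A+B\to (A+B)/R^e$ be the quotient map. Let $\preceq$ be the transitive closure $(\preceq_{A+B}/R^e)^t$ of the quotient relation $\preceq_{A+B}/R^e$. Then the preordered set $\langle (A+B)/R^e,\preceq\rangle$, together with the functions $[\cdot]\circ i_A$ and $[\cdot]\circ i_B$, is a pushout of $f$ and $g$ in the category of preordered sets and monotonic functions.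
   Context: A preordered set is a pair $\langle A,\preceq_A\rangle$ where $\preceq_A$ is a reflexive and transitive binary relation on $A$; a function $h$ between preordered sets is monotonic if $a\preceq a'$ implies $h(a)\preceq h(a')$. The coproduct preorder: $A+B=(A\times\{0\})\cup(B\times\{1\})$, $i_A(a)=\langle a,0\rangle$, $i_B(b)=\langle b,1\rangle$, and $\langle x,y\rangle\preceq_{A+B}\langle x',y'\rangle$ iff ($x\preceq_A x'$ and $y=y'=0$) or ($x\preceq_B x'$ and $y=y'=1$). For a binary relation $S$ and an equivalence relation $E$ on a set $D$, the quotient relation on $D/E$ is $S/E=\{\langle[a],[b]\rangle : \langle a,b\rangle\in S\}$. The transitive closure $S^t$ of a binary relation $S$ is the least transitive relation containing $S$. *)

(* Defs.v *)
From Stdlib Require Import Relations.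

Set Implicit Arguments.
Unset Strict Implicit.

Record category := {
  obj :> Type;
  hom : obj -> obj -> Type;
  idm : forall x, hom x x;
  comp : forall x y z, hom y z -> hom x y -> hom x z;
  comp_idl : forall x y (u : hom x y), comp (idm y) u = u;
  comp_idr : forall x y (u : hom x y), comp u (idm x) = u;
  comp_assoc : forall w x y z (u : hom y z) (v : hom x y) (t : hom w x),
    comp u (comp v t) = comp (comp u v) t
}.

Definition is_pushout (K : category) (C A B : K) (f : hom C A) (g : hom C B)
    (P : K) (p : hom A P) (q : hom B P) : Prop :=
  comp p f = comp q g /\
  forall (X : K) (h : hom A X) (k : hom B X),
    comp h f = comp k g ->
    exists! u : hom P X, comp u p = h /\ comp u q = k.

Record preordset := Preordset {
  carrier :> Type;
  pre : relation carrier;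
  preP : preorder carrier pre
}.

Definition monotonic (A B : preordset) (h : A -> B) : Prop :=
  forall a a' : A, pre a a' -> pre (h a) (h a').

Record monofun (A B : preordset) := Monofun {
  fn :> A -> B;
  fnP : monotonic fn
}.

Definition mono_id (A : preordset) : monofun A A :=
  Monofun (fn := fun a : A => a) (fun _ _ le => le).

Definition mono_comp (A B C : preordset) (h : monofun B C) (k : monofun A B) :
    monofun A C :=
  Monofun (fn := fun a => h (k a)) (fun _ _ le => fnP h (fnP k le)).

Lemma mono_comp_idl (A B : preordset) (u : monofun A B) :
  mono_comp (mono_id B) u = u.
Proof. destruct u; reflexivity. Qed.

Lemma mono_comp_idr (A B : preordset) (u : monofun A B) :
  mono_comp u (mono_id A) = u.
Proof. destruct u; reflexivity. Qed.

Lemma mono_comp_assoc (A B C D : preordset)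
    (u : monofun C D) (v : monofun B C) (t : monofun A B) :
  mono_comp u (mono_comp v t) = mono_comp (mono_comp u v) t.
Proof. reflexivity. Qed.

Definition Preord : category :=
  {| obj := preordset; hom := monofun; idm := mono_id; comp := mono_comp;
     comp_idl := mono_comp_idl; comp_idr := mono_comp_idr;
     comp_assoc := mono_comp_assoc |}.

Definition sum_pre (A B : preordset) : relation (A + B) := fun x y =>
  match x, y with
  | inl a, inl a' => pre a a'
  | inr b, inr b' => pre b b'
  | _, _ => False
  end.

Lemma sum_preP (A B : preordset) : preorder (A + B) (@sum_pre A B).
Proof.
destruct (preP A) as [rA tA]; destruct (preP B) as [rB tB]; split.
- intros [a|b]; [apply rA | apply rB].
- intros [x|x] [y|y] [z|z]; simpl; try tauto; [apply tA | apply tB].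
Qed.

Definition coproduct (A B : preordset) : preordset := Preordset (@sum_preP A B).

(* D/E as the set of classes {b | E a b}. When E is an equivalence relation,
   Leibniz equality of [cls E a] and [cls E b] amounts to E a b, by functional
   and propositional extensionality and proof irrelevance. *)
Definition quotient (D : Type) (E : relation D) : Type :=
  {P : D -> Prop | exists a, P = E a}.

Definition cls (D : Type) (E : relation D) (a : D) : quotient E :=
  exist _ (E a) (ex_intro _ a eq_refl).

Definition quotient_rel (D : Type) (S E : relation D) : relation (quotient E) :=
  fun x y => exists a b, S a b /\ x = cls E a /\ y = cls E b.

(* Main.v *)
Require Import Defs.
From Stdlib Require Import Relations.
From Stdlib Require Import FunctionalExtensionality PropExtensionality.
From Stdlib Require Import ProofIrrelevance ClassicalEpsilon.

(** The relation [R^e] identifies [f c] with [g c], so a cocone [(h, k)] is the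
    same thing as a map on [A + B] constant on the classes of [R^e], hence a map
    on the quotient. The quotient relation is mapped into the target preorder,
    and therefore so is its transitive closure, because the target is transitive. *)

(** By proof irrelevance the monotonicity proofs do not distinguish two morphisms, so arrow
    equations can be checked pointwise. *)
Lemma monofun_ext (A B : preordset) (u v : monofun A B) :
  (forall a, u a = v a) -> u = v.
Proof.
destruct u as [u mu], v as [v mv]; simpl; intro uv.
assert (e : u = v) by (apply functional_extensionality; exact uv).
subst v; f_equal; apply proof_irrelevance.
Qed.

Lemma cls_surj (D : Type) (E : relation D) (x : quotient E) :
  exists a, x = cls E a.
Proof.
destruct x as [P [a Pa]]; exists a; subst P; reflexivity.
Qed.

Lemma cls_eq (D : Type) (E : relation D) (a b : D) :
  equivalence D E -> cls E a = cls E b <-> E a b.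
Proof.
intros [r t s]; split.
(* The first projection turns equality of classes into [E a = E b] as predicates, which reduces the
   goal to [E b b]. *)
- intro e; apply (f_equal (@proj1_sig _ _)) in e; simpl in e.
  rewrite e; apply r.
- intro ab; apply eq_sig_hprop; [intros; apply proof_irrelevance|].
  apply functional_extensionality; intro x.
  apply propositional_extensionality; split; intro H.
  + exact (t _ _ _ (s _ _ ab) H).
  + exact (t _ _ _ ab H).
Qed.

(** A class holds its representative only under an existential in [Prop], so the lift picks one by
    indefinite description; compatibility of [phi] makes the value independent of the choice. *)
Lemma quotient_lift (D T : Type) (E : relation D) (phi : D -> T) :
  equivalence D E -> (forall a b, E a b -> phi a = phi b) ->
  exists u : quotient E -> T, forall a, u (cls E a) = phi a.
Proof.
intros eqE compat.
pose (rep x := constructive_indefinite_description _ (cls_surj D E x)).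
exists (fun x => phi (proj1_sig (rep x))); intro a.
destruct (rep (cls E a)) as [b ab]; simpl.
symmetry; apply compat, cls_eq; assumption.
Qed.

(** The kernel of [phi] is an equivalence relation, so it contains the least one above [R]. *)
Lemma clos_rst_compat (D T : Type) (R : relation D) (phi : D -> T) :
  (forall a b, R a b -> phi a = phi b) ->
  forall a b, clos_refl_sym_trans D R a b -> phi a = phi b.
Proof.
intros compat a b ab; induction ab; auto; congruence.
Qed.

(** The closure supplies transitivity only; reflexivity is inherited from [S], since every class has
    a representative. *)
Lemma quotient_rel_clos_preorder (D : Type) (S E : relation D) :
  reflexive D S ->
  preorder (quotient E) (clos_trans _ (quotient_rel S (E := E))).
Proof.
intro rS; split.
- intro x; destruct (cls_surj D E x) as [a ->].
  apply t_step; exists a, a; auto.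
- intros x y z; apply t_trans.
Qed.

Lemma clos_quotient_rel_mono (D : Type) (S E : relation D) (X : preordset)
    (u : quotient E -> X) :
  (forall a b, S a b -> pre (u (cls E a)) (u (cls E b))) ->
  forall x y, clos_trans _ (quotient_rel S (E := E)) x y -> pre (u x) (u y).
Proof.
intros mono x y xy; induction xy as [x y [a [b [ab [-> ->]]]]|x y z _ IH1 _ IH2].
- apply mono, ab.
- exact (preord_trans _ _ (preP X) _ _ _ IH1 IH2).
Qed.

Theorem lemma4p4p2 (A B C : preordset) (f : monofun C A) (g : monofun C B) :
  let AB := coproduct A B in
  let iA : A -> AB := inl in
  let iB : B -> AB := inr in
  let Re : relation AB :=
    clos_refl_sym_trans AB (fun x y => exists c : C, x = iA (f c) /\ y = iB (g c)) in
  let Q := quotient Re in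
  let le : relation Q := clos_trans Q (quotient_rel (@pre AB) (E := Re)) in
  exists leP : preorder Q le,
    let P := Preordset leP in
    exists (pP : @monotonic A P (fun a => cls Re (iA a)))
           (qP : @monotonic B P (fun b => cls Re (iB b))),
      @is_pushout Preord C A B f g P (Monofun pP) (Monofun qP).
Proof.
intros AB iA iB Re Q le.
assert (eqRe : equivalence AB Re) by apply clos_rst_is_equiv.
assert (leP : preorder Q le)
  by apply quotient_rel_clos_preorder, (preord_refl _ _ (preP AB)).
exists leP; intro P.
assert (pP : @monotonic A P (fun a => cls Re (iA a))).
{ intros a a' aa'; apply t_step; exists (iA a), (iA a'); auto. }
assert (qP : @monotonic B P (fun b => cls Re (iB b))).
{ intros b b' bb'; apply t_step; exists (iB b), (iB b'); auto. }
exists pP, qP; split.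
- apply monofun_ext; intro c; apply cls_eq; [exact eqRe|].
  apply rst_step; exists c; auto.
- intros X h k hk.
  pose (phi := fun x : AB => match x with inl a => fn h a | inr b => fn k b end).
  destruct (quotient_lift AB X Re phi eqRe) as [u uE].
  { apply clos_rst_compat; intros x y [c [-> ->]].
    (* On a generating pair of [Re], compatibility of [phi] is the cocone equation evaluated at
       [c]. *)
    exact (f_equal (fun w : monofun C X => w c) hk). }
  assert (mu : @monotonic P X u).
  { refine (clos_quotient_rel_mono AB _ Re X u _); intros x y xy; rewrite !uE.
    (* Elements of different summands are never related in [AB], so only the monotonicity of [h] and
       of [k] is needed. *)
    destruct x as [a|b], y as [a'|b']; simpl in xy; try contradiction.
    - exact (fnP h xy).
    - exact (fnP k xy). }
  exists (Monofun mu); split.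
  + split; apply monofun_ext; intro z; apply uE.
  + intros v [vp vq]; apply monofun_ext; intro x.
    (* Uniqueness: each element of [P] is the class of some [iA a] or [iB b], where the two
       triangles fix the value of [v]. *)
    destruct (cls_surj _ _ x) as [[a|b] ->].
    * exact (eq_trans (uE (iA a)) (f_equal (fun w : monofun A X => w a) (eq_sym vp))).
    * exact (eq_trans (uE (iB b)) (f_equal (fun w : monofun B X => w b) (eq_sym vq))).
Qed.
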